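(* Let $k\ge 2$ be an integer. For a real number $P\ge 1$, let $V_k^*(P)$ denote the number of pairs of integer $(k+1)$-tuples $\mathbf x=(x_1,\ldots,x_{k+1})$, $\mathbf y=(y_1,\ldots,y_{k+1})$ with $1\le x_i,y_i\le P$ $(1\le i\le k+1)$ satisfying \[ \sum_{i=1}^{k+1}x_i^{2j-1}=\sum_{i=1}^{k+1}y_i^{2j-1}\qquad (1\le j\le k), \] and let $L_k^*(P)$ denote the number of such pairs $(\mathbf x,\mathbf y)$ with $1\le x_i,y_i\le P$ in which $(x_1,\ldots,x_{k+1})$ is a permutation of $(y_1,\ldots,y_{k+1})$. Define \[ \alpha_k=\min_{\substack{r\in\mathbb N\\ 2\le r\le 2k+1}}\Bigl(r-1+\frac{2k+2}{r}\Bigr). \] Then for every $\varepsilon>0$ there is a constant $C=C(k,\varepsilon)$ such that for all $P\ge 1$, \[ V_k^*(P)-L_k^*(P)\le C P^{\alpha_k+\varepsilon}. \] In particular, for every $\varepsilon>0$ there is $C'=C'(k,\varepsilon)$ such that $V_k^*(P)-L_k^*(P)\le C' P^{\sqrt{8k+9}-1+\varepsilon}$ for all $P\ge 1$. *)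

(* Defs.v *)
From mathcomp Require Import all_boot all_order all_algebra finmap.
From mathcomp Require Import all_classical all_reals all_analysis.

Set Implicit Arguments.
Unset Strict Implicit.
Unset Printing Implicit Defensive.

Import Order.TTheory GRing.Theory Num.Theory.

Local Open Scope classical_set_scope.
Local Open Scope ring_scope.

Definition int_box (R : realType) (n : nat) (P : R) : set (n.-tuple int) :=
  [set x | forall i, (1 : R) <= (tnth x i)%:~R <= P].

Definition odd_power_system (k s : nat) (x y : s.-tuple int) : Prop :=
  forall j : nat, (1 <= j <= k)%N ->
    \sum_(i < s) tnth x i ^+ (2 * j - 1) = \sum_(i < s) tnth y i ^+ (2 * j - 1).

Definition solutions (R : realType) (k : nat) (P : R) :
    set (k.+1.-tuple int * k.+1.-tuple int) :=
  [set xy | [/\ int_box P xy.1, int_box P xy.2 & odd_power_system k xy.1 xy.2]].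
Arguments solutions {R} k P _.

Definition diagonal_pairs (R : realType) (k : nat) (P : R) :
    set (k.+1.-tuple int * k.+1.-tuple int) :=
  [set xy | [/\ int_box P xy.1, int_box P xy.2 & perm_eq xy.1 xy.2]].
Arguments diagonal_pairs {R} k P _.

(* [fset_set A] is the empty finite set when [A] is infinite; the two sets
   counted below are finite, see [finite_solutions] and
   [finite_diagonal_pairs]. *)
Definition Vstar (R : realType) (k : nat) (P : R) : nat :=
  #|` fset_set (solutions k P)|%fset.

Definition Lstar (R : realType) (k : nat) (P : R) : nat :=
  #|` fset_set (diagonal_pairs k P)|%fset.

Definition alpha_term (R : realType) (k r : nat) : R :=
  r%:R - 1 + (2 * k + 2)%:R / r%:R.

(* The seed of the iterated minimum is the term r = 2, which lies in the range
   as soon as k >= 1, so this is the minimum over 2 <= r <= 2k+1; see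
   [alpha_le] and [alpha_attained]. *)
Definition alpha (R : realType) (k : nat) : R :=
  \big[Num.min/alpha_term R k 2]_(2 <= r < (2 * k).+2) alpha_term R k r.

Lemma finite_int_box (R : realType) (n : nat) (P : R) :
  finite_set (@int_box R n P).
Proof.
pose f (t : n.-tuple 'I_(Num.truncn P).+1) : n.-tuple int :=
  [tuple (tnth t i : nat)%:Z | i < n].
apply: (@sub_finite_set _ _ (f @` setT)); last first.
  exact/finite_image/finite_finset.
move=> x xP; exists [tuple inord `|tnth x i|%N | i < n] => //.
apply: eq_from_tnth => i; rewrite !tnth_mktuple.
have /andP[x1 xleP] := xP i.
have x0 : 0 <= tnth x i by rewrite -(ler0z R) (le_trans ler01).
have xE : (`|tnth x i|%N : int) = tnth x i by rewrite gez0_abs.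
rewrite inordK // ltnS truncn_ge_nat; last first.
  exact: le_trans ler01 (le_trans x1 xleP).
by rewrite -[_%:R]/((Posz _)%:~R) xE.
Qed.

Lemma finite_solutions (R : realType) (k : nat) (P : R) :
  finite_set (@solutions R k P).
Proof.
apply: sub_finite_set (finite_setX (finite_int_box k.+1 P)
                                   (finite_int_box k.+1 P)).
by move=> xy [].
Qed.

Lemma finite_diagonal_pairs (R : realType) (k : nat) (P : R) :
  finite_set (@diagonal_pairs R k P).
Proof.
apply: sub_finite_set (finite_setX (finite_int_box k.+1 P)
                                   (finite_int_box k.+1 P)).
by move=> xy [].
Qed.

Lemma alpha_le (R : realType) (k r : nat) :
  (2 <= r <= (2 * k).+1)%N -> alpha R k <= alpha_term R k r.
Proof.
move=> /andP[r2 rk]; rewrite /alpha.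
by apply: ge_bigmin_seq; rewrite ?mem_index_iota ?r2.
Qed.

Lemma alpha_attained (R : realType) (k : nat) : (1 <= k)%N ->
  exists2 r : nat, (2 <= r <= (2 * k).+1)%N & alpha R k = alpha_term R k r.
Proof.
move=> k1; rewrite /alpha big_seq.
elim/big_ind: _ => [|x y [r hr ->] [s hs ->]|r].
- by exists 2%N => //=; rewrite ltnS mul2n -addnn (leq_trans k1)// leq_addr.
- by rewrite /Num.min; case: ifP => _; [exists r|exists s].
- by rewrite mem_index_iota ltnS => hr; exists r.
Qed.

(* Main.v *)
Require Import Defs.
From mathcomp Require Import all_boot all_order all_algebra all_fingroup finmap.
From mathcomp Require Import all_classical all_reals all_analysis.
From mathcomp Require Import ring lra zify.

Import Order.TTheory GRing.Theory Num.Theory.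
Local Open Scope ring_scope.

(* Put z = (x, -y), of length n = 2k+2. By Newton's identities the odd
   elementary symmetric functions of z of degree < 2k vanish, so evaluating
   prod_i (1 + z_i X) at 1/w and -1/w, for w an entry of z, gives
   prod_i (z_i + w) = 2 w c with c = e_{2k+1}(z), the same for all w; and c = 0
   only when x is a permutation of y. If z takes fewer than r distinct values
   there are O(P^{r-1}) choices for it. Otherwise fix r distinct entries
   a_1, ..., a_r; for the s = n - r other entries t_i, the r products
   prod_i (t_i + a_m) agree up to primes dividing a bounded integer L. For one
   entry t_1, the parts prime to L of the numbers t_1 + a_m are pairwise coprime,
   so their product divides the common value of the r products, and the smallest
   of them, which determines t_1 up to P^eps choices, is at most the r-th root of
   that product. Adjoining the primes of the t_1 + a_m to L and iterating, the t_i
   can be chosen in about P^{s/r} ways, whence the exponent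
   r + s/r = r - 1 + n/r. *)

(** * Newton's identities and the common product *)

(** The coefficient of [X^i] is the elementary symmetric function of degree [i] of the entries of
    [z]. *)
Definition elem_gen (z : seq int) : {poly int} := \prod_(u <- z) (1 + u *: 'X).

Lemma elem_gen_cons u z : elem_gen (u :: z) = (1 + u *: 'X) * elem_gen z.
Proof. by rewrite /elem_gen big_cons. Qed.

(** Logarithmic differentiation of the product. Each [u / (1 + u X)] is replaced by its geometric
    series cut at order [N], which keeps the identity among polynomials with error a multiple of
    [X^N]. *)
Lemma newton_gen (z : seq int) (N : nat) : exists Q : {poly int},
  (elem_gen z)^`() =
  elem_gen z * (\sum_(u <- z) u *: \sum_(j < N) (- u *: 'X) ^+ j) + 'X^N * Q.
Proof.
elim: z => [|u z [Q IH]].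
  by exists 0; rewrite /elem_gen !big_nil derivC !mulr0 addr0.
exists ((1 + u *: 'X) * Q + u *: ((- u) ^+ N *: elem_gen z)).
have geo : (1 + u *: 'X) * \sum_(j < N) (- u *: 'X) ^+ j =
    1 - (- u) ^+ N *: 'X^N :> {poly int}.
  have := subrX1 (- u *: 'X : {poly int}) N; rewrite exprZn => /esym e.
  by rewrite -[RHS]opprB -e -mulNr scaleNr opprB opprK.
rewrite elem_gen_cons big_cons derivM IH derivD derivC derivZ derivX add0r.
move: geo; set G := elem_gen z; set S := \sum_(j <- z) _; set T := \sum_(j < N) _.
move=> geo; rewrite -!mul_polyC in geo *.
have -> : (1 + u%:P * 'X) * G * (u%:P * T + S) =
  u%:P * G * ((1 + u%:P * 'X) * T) + (1 + u%:P * 'X) * G * S by ring.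
rewrite geo; ring.
Qed.

Lemma newton_identity (z : seq int) (m : nat) :
  m.+1%:R * (elem_gen z)`_m.+1 =
  \sum_(j < m.+1) (elem_gen z)`_(m - j) *
     ((-1) ^+ j * \sum_(u <- z) u ^+ j.+1).
Proof.
have [Q /(congr1 (fun p : {poly int} => p`_m))] := newton_gen z m.+1.
rewrite coef_deriv coefD coefXnM ltnSn addr0 mulr_natl => ->.
rewrite coefMr; apply: eq_bigr => j _; congr (_ * _).
rewrite mulr_sumr coef_sum; apply: eq_bigr => u _.
rewrite coefZ coef_sum (bigD1 j)//= exprZn coefZ coefXn eqxx mulr1.
rewrite big1 ?addr0 => [|i ij]; first by rewrite (exprNn u) exprS; ring.
by rewrite exprZn coefZ coefXn (_ : (_ == _) = false) ?mulr0//; apply/eqP => /val_inj e;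
  rewrite e eqxx in ij.
Qed.

(** Strong induction on the odd index: in each term of Newton's identity either the power sum has
    odd exponent and vanishes by hypothesis, or the coefficient has smaller odd index and vanishes
    by induction. *)
Lemma odd_elem_eq0 (k : nat) (z : seq int) :
  (forall j, (1 <= j <= k)%N -> \sum_(u <- z) u ^+ (2 * j - 1) = 0) ->
  forall m, odd m -> (m < 2 * k)%N -> (elem_gen z)`_m = 0.
Proof.
move=> hp; elim/ltn_ind => -[//|m] IH /= m_odd mk.
have := newton_identity z m; rewrite big1 => [/eqP|j _].
  by rewrite mulf_eq0 pnatr_eq0 /= => /eqP.
have [jodd|jev] := boolP (odd j).
  rewrite IH ?mul0r//; first by have := ltn_ord j; lia.
    by rewrite oddB ?jodd ?addbT// -ltnS.
  by have := ltn_ord j; lia.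
have -> : j.+1 = (2 * j./2.+1 - 1)%N by have := odd_double_half j; lia.
by rewrite hp ?mulr0//; have := ltn_ord j; lia.
Qed.

Lemma size_elem_gen z : (size (elem_gen z) <= (size z).+1)%N.
Proof.
elim: z => [|u z IH]; first by rewrite /elem_gen big_nil size_poly1.
rewrite elem_gen_cons mulrDl mul1r (leq_trans (size_polyD _ _))// geq_max /=.
rewrite (leq_trans IH)//= -scalerAl (leq_trans (size_scale_leq _ _))//.
by rewrite (leq_trans (size_polyMleq _ _))// size_polyX.
Qed.

Lemma horner_elem_gen (z : seq int) (v : int) : v != 0 ->
  (\prod_(u <- z) (v + u))%:~R =
  v%:~R ^+ size z * (map_poly intr (elem_gen z)).[v%:~R^-1] :> rat.
Proof.
move=> v0; elim: z => [|u z IH].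
  by rewrite /elem_gen !big_nil !rmorph1 hornerC expr0 mulr1.
have lin : map_poly intr (1 + u *: 'X) = 1 + u%:~R *: 'X :> {poly rat}.
  by rewrite rmorphD rmorph1 /= map_polyZ map_polyX.
rewrite big_cons elem_gen_cons !rmorphM /= lin hornerM IH.
rewrite hornerD hornerZ hornerX hornerC exprS intrD.
by field; rewrite intr_eq0.
Qed.

(** The difference retains only odd degrees. The degree is at most [2k+2] and the odd coefficients
    below [2k] vanish, so degree [2k+1] alone survives. *)
Lemma odd_part_elem_gen (k : nat) (z : seq int) :
  size z = (2 * k + 2)%N ->
  (forall j, (1 <= j <= k)%N -> \sum_(u <- z) u ^+ (2 * j - 1) = 0) ->
  forall t : rat, (map_poly intr (elem_gen z)).[t]
    - (map_poly intr (elem_gen z)).[- t]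
    = 2 * ((elem_gen z)`_(2 * k + 1))%:~R * t ^+ (2 * k + 1).
Proof.
move=> sz hp t; set G := map_poly _ _.
have szG : (size G <= 2 * k + 3)%N.
  by rewrite (leq_trans (size_poly _ _))// (leq_trans (size_elem_gen _))// sz; lia.
rewrite !(horner_coef_wide _ szG) -sumrB.
have kk : (2 * k + 1 < 2 * k + 3)%N by lia.
rewrite (bigD1 (Ordinal kk))//= big1 => [|i ik].
  have -> : (- t) ^+ (2 * k + 1) = - t ^+ (2 * k + 1).
    by rewrite exprNn -signr_odd oddD mul2n odd_double expr1 mulN1r.
  by rewrite coef_map /=; ring.
rewrite coef_map /=; case: (boolP (odd i)) => [iodd|iev].
  rewrite (odd_elem_eq0 k)// ?mul0r ?subr0//.
  have : (i : nat) <> (2 * k + 1)%N.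
    by move=> e; move/eqP: ik; apply; apply: val_inj.
  by have := ltn_ord i; have := odd_double_half i; lia.
by rewrite (exprNn t) -signr_odd (negbTE iev) mul1r subrr.
Qed.

(* Evaluate at [1/v]; the value at [-1/v] vanishes. *)
Lemma prod_add_odd_system (k : nat) (z : seq int) (v : int) :
  size z = (2 * k + 2)%N ->
  (forall j, (1 <= j <= k)%N -> \sum_(u <- z) u ^+ (2 * j - 1) = 0) ->
  v \in z -> v != 0 ->
  \prod_(u <- z) (u + v) = 2 * v * (elem_gen z)`_(2 * k + 1).
Proof.
move=> sz hp vz v0.
have vq0 : v%:~R != 0 :> rat by rewrite intr_eq0.
have := odd_part_elem_gen _ _ sz hp (v%:~R^-1).
have nv0 : - v != 0 by rewrite oppr_eq0.
have := horner_elem_gen z (- v) nv0.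
have -> : \prod_(u <- z) (- v + u) = 0.
  apply/eqP; rewrite prodf_seq_eq0; apply/hasP; exists v => //=.
  by rewrite addNr.
move/eqP; rewrite eq_sym mulf_eq0 expf_eq0 rmorphN oppr_eq0 (negbTE vq0) andbF /=.
rewrite invrN => /eqP ->; rewrite subr0 => e.
apply: (@intr_inj rat); under eq_bigr do rewrite addrC.
rewrite horner_elem_gen// e sz !rmorphM /= addn2 addn1 [_ ^+ (2 * k).+2]exprS.
have : (v%:~R ^+ (2 * k).+1) * (v%:~R^-1 ^+ (2 * k).+1) = 1 :> rat.
  by rewrite -exprMn divff// expr1n.
move: (_ ^+ _) (_ ^+ _) => a b ab; rewrite -[LHS]mulr1.
by ring: ab.
Qed.

Lemma elem_gen_opp z i :
  (elem_gen (map -%R z))`_i = (-1) ^+ i * (elem_gen z)`_i.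
Proof.
elim: z i => [|u z IH] i.
  by rewrite /elem_gen !big_nil coef1; case: i => //= i; rewrite mulr0.
rewrite /= !elem_gen_cons !mulrDl !mul1r !coefD IH -!scalerAl !coefZ !coefXM.
case: i => [|i] /=; first by rewrite !mulr0 mulrDr mulr0.
by rewrite IH exprS; ring.
Qed.

(** Over the rationals the roots of [elem_gen z] are the numbers [-1/u]; an entry 0 would contribute
    the factor 1 and leave no trace. *)
Lemma elem_gen_inj (s t : seq int) : 0 \notin s -> 0 \notin t ->
  elem_gen s = elem_gen t -> perm_eq s t.
Proof.
pose f (u : int) : rat := - (u%:~R)^-1.
have key z : 0 \notin z -> map_poly intr (elem_gen z) =
    (\prod_(u <- z) u%:~R) *: \prod_(x <- map f z) ('X - x%:P) :> {poly rat}.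
  elim: z => [_|u z IH].
    by rewrite /elem_gen !big_nil rmorph1 scale1r.
  rewrite inE negb_or eq_sym => /andP[u0 /IH e].
  have lin : map_poly intr (1 + u *: 'X) =
      u%:~R *: ('X - (f u)%:P) :> {poly rat}.
    rewrite rmorphD rmorph1 /= map_polyZ map_polyX /f scalerBr polyCN scalerN.
    by rewrite opprK -[u%:~R *: _%:P]mul_polyC -polyCM mulfV ?intr_eq0// addrC.
  rewrite elem_gen_cons rmorphM /= e /= !big_cons lin.
  by rewrite -scalerAl -scalerAr scalerA.
move=> s0 t0 st.
have : map_poly intr (elem_gen s) = map_poly intr (elem_gen t) :> {poly rat}.
  by rewrite st.
rewrite !key// => e.
have el := congr1 lead_coef e.
rewrite !lead_coefZ !lead_coef_prod_XsubC !mulr1 in el.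
have nz : \prod_(u <- s) u%:~R != 0 :> rat.
  rewrite prodf_seq_neq0; apply/allP => u us /=; rewrite intr_eq0.
  by apply: contraNneq s0 => <-.
move: e; rewrite -el => /(scalerI nz)/prod_XsubC_eq.
apply: perm_map_inj => u v /oppr_inj/invr_inj.
exact: intr_inj.
Qed.

(** * Harmonic sums over coprime parts *)

Lemma harmonic_le_ln (R : realType) (X : nat) :
  \sum_(1 <= u < X.+2) u%:R^-1 <= 1 + ln X.+1%:R :> R.
Proof.
elim: X => [|X IH]; first by rewrite big_nat1 invr1 ln1 addr0.
rewrite big_nat_recr//=; apply: (le_trans (lerD IH (lexx _))).
rewrite -addrA lerD2l -lerBrDr.
have X2 : 0 < X.+2%:R :> R by rewrite ltr0n.
have X1 : 0 < X.+1%:R :> R by rewrite ltr0n.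
(* This gives [ln (X+1) = ln (X+2) + ln (1 - 1/(X+2))], where the last term is at most
   [-1/(X+2)]. *)
have e : X.+1%:R = X.+2%:R * (1 + - X.+2%:R^-1) :> R.
  by rewrite mulrBr mulr1 divff ?gt_eqF// -[X.+2%:R]natr1 addrK.
have m1 : -1 < - X.+2%:R^-1 :> R by rewrite ltrN2 invf_lt1// ltr1n.
have Dpos : 0 < 1 + - X.+2%:R^-1 :> R by rewrite -(pmulr_rgt0 _ X2) -e.
by rewrite [X in ln X <= _]e lnM ?posrE// lerD2l le_ln1Dx.
Qed.

Lemma harmonic_le_powR (R : realType) (d : R) (X : nat) : 0 < d ->
  \sum_(1 <= u < X.+1) u%:R^-1 <= (1 + d^-1) * X%:R `^ d.
Proof.
move=> d0; have C0 : 0 <= 1 + d^-1 by rewrite addr_ge0// invr_ge0 ltW.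
case: X => [|X]; first by rewrite big_geq// mulr_ge0// powR_ge0.
apply: (le_trans (harmonic_le_ln _ _)); rewrite mulrDl mul1r.
have X1 : 1 <= X.+1%:R :> R by rewrite ler1n.
have P1 : 1 <= X.+1%:R `^ d by have := ler_powR X1 (ltW d0); rewrite powRr0.
apply: lerD => //.
(* The bound [d ln y = ln (y^d) <= y^d] follows from [ln (1 + x) <= x] at [x = y^d - 1]. *)
rewrite mulrC ler_pdivlMr// mulrC -ln_powR.
have := @le_ln1Dx R (X.+1%:R `^ d - 1); rewrite [1 + _]addrC subrK => h.
by rewrite (le_trans (h _)) ?lerBlDr ?lerDl// ltrBrDl addrN (lt_le_trans ltr01).
Qed.

Section smooth_harmonic.
Variables (R : realType) (d : R).
Hypothesis d0 : 0 < d.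

(** A list of primes in place of [L] allows an induction that adds one prime at a time, starting
    from the harmonic sum. *)
Let h (ps : seq nat) (X : nat) : R :=
  \sum_(1 <= u < X.+1) ((u`_[pred q | q \notin ps])%N)%:R^-1.

(* Separate the multiples of [p], whose part prime to [p :: ps] is unchanged
   on division by [p]. *)
Let h_cons (p : nat) (ps : seq nat) (X : nat) : prime p ->
  h (p :: ps) X <= h ps X + h (p :: ps) (X %/ p)%N.
Proof.
move=> pp; have p0 := prime_gt0 pp.
rewrite /h (bigID (fun u => p %| u)%N) /= addrC; apply: lerD.
  rewrite big_mkcond [leRHS]big_nat [leLHS]big_nat /=; apply: ler_sum => u /andP[u1 uX].
  case: ifP => [pu|_]; last by rewrite invr_ge0.
  rewrite (@eq_in_partn _ [pred q | q \notin ps])// => q.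
  rewrite mem_primes => /and3P[_ _ qu]; rewrite !inE.
  by case: eqP => // qp; rewrite -qp qu in pu.
rewrite -big_filter.
have -> : \sum_(u <- [seq u <- index_iota 1 X.+1 | (p %| u)%N])
    ((u`_[pred q | q \notin p :: ps])%N)%:R^-1 =
  \sum_(u <- [seq (p * v)%N | v <- index_iota 1 (X %/ p).+1])
    ((u`_[pred q | q \notin p :: ps])%N)%:R^-1 :> R.
  apply: perm_big; apply: uniq_perm.
  - by rewrite filter_uniq// iota_uniq.
  - rewrite map_inj_uniq ?iota_uniq// => u v /eqP.
    by rewrite eqn_pmul2l// => /eqP.
  move=> u; rewrite mem_filter mem_index_iota; apply/idP/mapP.
    move=> /and3P[/dvdnP[v ->]]; rewrite muln_gt0 => /andP[v0 _] vX.
    by exists v; rewrite 1?mulnC// mem_index_iota v0 ltnS leq_divRL.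
  move=> [v]; rewrite mem_index_iota ltnS leq_divRL// => /andP[v0 vX] ->.
  by rewrite dvdn_mulr//= muln_gt0 p0 v0 ltnS mulnC.
rewrite big_map big_nat [leRHS]big_nat; apply: ler_sum => v /andP[v0 _].
rewrite partnM// (@part_p'nat _ p) ?mul1n// pnatE//.
by rewrite !inE eqxx.
Qed.

(** The Euler factor at [p], which is the cost of removing one more prime. *)
Let g (p : nat) : R := (1 - (p%:R `^ d)^-1)^-1.

Let powR_gt1 p : prime p -> 1 < p%:R `^ d.
Proof.
move=> /prime_gt1 p1; have := @gt0_ltr_powR _ _ d0 1 p%:R.
by rewrite powR1; apply; rewrite ?nnegrE ?ltr1n.
Qed.

(** Induction on [ps], then on [X] through [h_cons]: since [(X/p)^d <= X^d p^(-d)], the recursion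
    closes by [g p = 1 + p^(-d) g p]. *)
Let h_le (ps : seq nat) (X : nat) : all prime ps ->
  h ps X <= (1 + d^-1) * X%:R `^ d * \prod_(p <- ps) g p.
Proof.
have C0 : 0 <= 1 + d^-1 by rewrite addr_ge0// invr_ge0 ltW.
elim: ps X => [|p ps IHps] X /=.
  move=> _; rewrite big_nil mulr1; apply: le_trans (harmonic_le_powR _ _ _ d0).
  rewrite /h [leRHS]big_nat [leLHS]big_nat; apply: ler_sum => u /andP[u1 _].
  rewrite (@eq_partn _ predT) ?partnT//.
move=> /andP[pp psp].
have x1 := powR_gt1 _ pp; have x0 := lt_trans ltr01 x1.
have y1 : 0 < 1 - (p%:R `^ d)^-1 by rewrite subr_gt0 invf_lt1.
have G0 : 0 <= \prod_(q <- ps) g q.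
  rewrite big_seq; apply: prodr_ge0 => q /(allP psp)/powR_gt1 q1.
  by rewrite invr_ge0 subr_ge0 invf_le1 ?ltW// (lt_trans ltr01).
have gp0 : 0 <= g p by rewrite invr_ge0 ltW.
elim/ltn_ind: X => -[_|X IHX].
  by rewrite /h big_geq// mulr_ge0 ?mulr_ge0 ?powR_ge0// big_cons mulr_ge0.
apply: le_trans (h_cons _ _ _ pp) _.
have Xp : (X.+1 %/ p < X.+1)%N by rewrite ltn_Pdiv// prime_gt1.
apply: le_trans (lerD (IHps X.+1 psp) (IHX _ Xp)) _.
have Xle : (X.+1 %/ p)%:R `^ d <= X.+1%:R `^ d * (p%:R `^ d)^-1.
  rewrite ler_pdivlMr// -powRM// (ge0_ler_powR (ltW d0)) ?nnegrE ?mulr_ge0//.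
  by rewrite -natrM ler_nat leq_trunc_div.
rewrite big_cons; move: Xle.
set a := _ `^ d; set b := _ `^ d; set c := (_ `^ d)^-1; set G := \prod_(_ <- _) _.
move=> abc.
have -> : (1 + d^-1) * b * (g p * G) =
   (1 + d^-1) * b * G + (1 + d^-1) * (b * c) * (g p * G).
  have : g p * (1 - c) = 1 by rewrite /g mulVf// gt_eqF.
  move: (1 + d^-1) (g p) => C y e.
  have {e} e : y = 1 + c * y by rewrite -e; ring.
  by rewrite {1}e; ring.
rewrite lerD2l ler_wpM2r ?mulr_ge0// ler_wpM2l//.
Qed.

(* [1/(1 - 1/x) <= x] as soon as [x = p ^ d >= 2], so only the finitely many
   smaller primes contribute to the constant. *)
Let prod_g_le : exists2 C : R, 0 <= C &
  forall L : nat, (0 < L)%N -> \prod_(p <- primes L) g p <= C * L%:R `^ d.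
Proof.
pose G0 := g 2.
have x2 : 1 < 2%:R `^ d := powR_gt1 2 isT.
have G1 : 1 <= G0.
  have y0 : 0 < 1 - (2%:R `^ d)^-1 by rewrite subr_gt0 invf_lt1 ?(lt_trans ltr01).
  by rewrite invf_ge1// gerBl invr_ge0 powR_ge0.
(* Beyond [2^(1/d)] every [p] has [p^d >= 2]. *)
pose p0 := (Num.truncn ((2 : R) `^ d^-1)).+1.
have p0P p : (p0 <= p)%N -> 2 <= p%:R `^ d.
  have e2 : 2 = (2 `^ d^-1) `^ d :> R by rewrite -powRrM mulVf ?gt_eqF// powRr1.
  move=> hpp; rewrite [leLHS]e2.
  rewrite (ge0_ler_powR (ltW d0)) ?nnegrE ?powR_ge0//.
  by rewrite (le_trans (ltW (truncnS_gt _)))// ler_nat.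
pose e p : R := if (p < p0)%N then G0 else 1.
have e1 p : 1 <= e p by rewrite /e; case: ifP.
have gle p : prime p -> g p <= e p * p%:R `^ d.
  move=> pp; have x1 := powR_gt1 _ pp; have x0 := lt_trans ltr01 x1.
  have y1 : 0 < 1 - (p%:R `^ d)^-1 by rewrite subr_gt0 invf_lt1.
  rewrite /e; case: ltnP => pp0.
    apply: (@le_trans _ _ G0).
      rewrite /G0 /g lef_pV2 ?posrE// ?subr_gt0 ?invf_lt1// ?(lt_trans ltr01)//.
      rewrite lerD2l lerN2 lef_pV2 ?posrE// ?(lt_trans ltr01)//.
      by rewrite (ge0_ler_powR (ltW d0)) ?nnegrE// ler_nat prime_gt1.
    by rewrite ler_peMr ?(le_trans ler01)// ltW.
  rewrite mul1r /g -[leRHS]invrK lef_pV2 ?posrE ?invr_gt0//.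
  have := p0P _ pp0; move: x0; set x := _ `^ _ => x0 xge2.
  rewrite lerBrDr -mulr2n -mulr_natr ler_pdivrMl//.
  by rewrite mulr1.
exists (G0 ^+ p0); first by rewrite exprn_ge0// (le_trans ler01).
move=> L L0.
have g0 p : prime p -> 0 <= g p.
  move=> /powR_gt1 x1; rewrite invr_ge0 subr_ge0 invf_le1 ?ltW//.
  exact: lt_trans ltr01 x1.
(* Fewer than [p0] distinct primes carry the factor [G0], and the primes dividing [L] multiply to at
   most [L]. *)
apply: (@le_trans _ _ (\prod_(p <- primes L) (e p * p%:R `^ d))).
  rewrite big_seq [leRHS]big_seq; apply: ler_prod => p.
  by rewrite mem_primes => /and3P[pp _ _]; rewrite g0// gle.
rewrite big_split /=; apply: ler_pM.
- by apply: prodr_ge0 => p _; rewrite (le_trans ler01).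
- by apply: prodr_ge0 => p _; rewrite powR_ge0.
- rewrite /e -big_mkcond /= big_const_seq iter_mulr_1 ler_weXn2l//.
  rewrite -size_filter -[leqRHS](size_iota 0) uniq_leq_size ?filter_uniq ?primes_uniq//.
  by move=> p; rewrite mem_filter mem_iota add0n => /andP[].
have -> : \prod_(p <- primes L) (p%:R `^ d) = (\prod_(p <- primes L) p)%:R `^ d.
  elim: (primes L) => [|p s IH]; first by rewrite !big_nil powR1.
  by rewrite !big_cons IH natrM powRM.
rewrite (ge0_ler_powR (ltW d0)) ?nnegrE// ler_nat.
rewrite [leqRHS](prod_prime_decomp L0) prime_decompE big_map /=.
rewrite big_seq [leqRHS]big_seq; apply: leq_prod => p pL.
by rewrite -{1}(expn1 p) leq_pexp2l ?logn_gt0//; move: pL;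
  rewrite mem_primes => /andP[/prime_gt0].
Qed.

(** Removing from each [u] the primes of [L] keeps the sum below an arbitrarily small power of
    [X L], with a constant uniform in [L]. This is what allows [L] to grow during factor
    extraction. *)
Lemma smooth_harmonic_le : exists2 C : R, 0 <= C &
  forall L X : nat, (0 < L)%N ->
    \sum_(1 <= u < X.+1) ((u`_\pi(L)^')%N)%:R^-1 <= C * (X%:R * L%:R) `^ d.
Proof.
have C0 : 0 <= 1 + d^-1 by rewrite addr_ge0// invr_ge0 ltW.
have [C Cge0 CP] := prod_g_le.
exists ((1 + d^-1) * C); first by rewrite mulr_ge0.
move=> L X L0.
have -> : \sum_(1 <= u < X.+1) ((u`_\pi(L)^')%N)%:R^-1 = h (primes L) X.
  by apply: eq_bigr => u _; congr (_%:R^-1); apply: eq_partn.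
have : h (primes L) X <= (1 + d^-1) * X%:R `^ d * \prod_(p <- primes L) g p.
  by apply: h_le; apply/allP => p; rewrite mem_primes => /andP[].
move=> /le_trans; apply;
  rewrite powRM// -!mulrA ler_wpM2l// mulrCA ler_wpM2l ?powR_ge0//.
exact: CP.
Qed.
End smooth_harmonic.

(** * Factor extraction *)

Lemma sum_tupleS (V : nmodType) (T : finType) (n : nat) (P : pred (seq T))
    (F : seq T -> V) :
  \sum_(t : n.+1.-tuple T | P t) F t =
  \sum_(x : T) \sum_(t : n.-tuple T | P (x :: t)) F (x :: t).
Proof.
rewrite pair_big_dep /=.
pose f (p : T * n.-tuple T) : n.+1.-tuple T := [tuple of p.1 :: p.2].
rewrite (reindex f) //=; exists (fun t => (thead t, [tuple of behead t])).
  by move=> [x t] _; rewrite /f theadE; congr pair; apply: val_inj.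
by move=> t _; rewrite [in RHS](tuple_eta t); apply: val_inj.
Qed.

Lemma dvdn_prod_coprime (I : eqType) (s : seq I) (w : I -> nat) (c : nat) :
  uniq s -> (forall i, (w i %| c)%N) ->
  (forall i j, i != j -> coprime (w i) (w j)) ->
  (\prod_(i <- s) w i %| c)%N.
Proof.
move=> us wc cw; elim: s us => [|i s IH]; first by rewrite big_nil dvd1n.
rewrite /= => /andP[iNs us]; rewrite big_cons Gauss_dvd ?wc ?IH//.
rewrite big_seq; elim/big_ind: _ => [|m n cm cn|j js]; first exact: coprimen1.
  by rewrite coprimeMr cm.
by apply: cw; apply: contraNneq iNs => ->.
Qed.

(** Here [U i] comes from one entry and [A i] from the remaining ones. Away from [L] the [U i] are
    pairwise coprime divisors of [c]; passing to [L'] removes them from [c] and leaves the common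
    part of the [A i]. *)
Lemma coprime_part_split (I : finType) (L c : nat) (U A : I -> nat) :
  (0 < L)%N -> (forall i, (0 < U i)%N) -> (forall i, (0 < A i)%N) ->
  (forall i j, i != j -> (gcdn (U i) (U j) %| L)%N) ->
  (forall i, ((U i * A i)`_\pi(L)^')%N = c) ->
  forall L' : nat, L' = (L * \prod_i U i)%N ->
  (forall i, ((A i)`_\pi(L')^' = c`_\pi(L')^')%N) /\
  (\prod_i (U i)`_\pi(L)^' * c`_\pi(L')^' %| c)%N.
Proof.
move=> L0 U0 A0 gUL Uc L' L'E.
have L'0 : (0 < L')%N by rewrite L'E muln_gt0 L0 prodn_gt0.
have UL' i : (U i %| L')%N by rewrite L'E dvdn_mull// (bigD1 i)//= dvdn_mulr.
have sub : {subset \pi(L')^' <= \pi(L)^'}.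
  move=> p; apply: contra; apply: pi_of_dvd => //.
  by rewrite L'E dvdn_mulr.
have Unat i : (\pi(L')^'^').-nat (U i).
  apply/pnatP => // p pp pU; rewrite /negn !inE negbK mem_primes pp L'0.
  exact: dvdn_trans (UL' i).
have wnat i : (\pi(L')^'^').-nat ((U i)`_\pi(L)^')%N.
  exact: pnat_dvd (dvdn_part _ _) (Unat i).
split.
  move=> i; rewrite -(Uc i) partn_part// partnM//.
  by rewrite (part_p'nat (Unat i)) mul1n.
have wc i : ((U i)`_\pi(L)^' %| c)%N by rewrite -(Uc i) partnM// dvdn_mulr.
rewrite Gauss_dvd ?dvdn_part ?andbT.
  apply: dvdn_prod_coprime => //; first exact: index_enum_uniq.
  move=> i j ij; rewrite /coprime -dvdn1.
  set g := gcdn _ _.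
  have g0 : (0 < g)%N by rewrite gcdn_gt0 part_gt0.
  have gL : (g %| L)%N.
    apply: dvdn_trans (gUL _ _ ij).
    by rewrite dvdn_gcd (dvdn_trans (dvdn_gcdl _ _)) ?(dvdn_trans (dvdn_gcdr _ _))
      ?dvdn_part.
  have gnat : (\pi(L)^').-nat g by apply: pnat_dvd (dvdn_gcdl _ _) (part_pnat _ _).
  rewrite dvdn1; apply/eqP; apply: (@pnat_1 \pi(L)) => //.
  exact: pnat_dvd gL (pnat_pi _).
rewrite coprime_sym; elim/big_ind: _ => [|m n cm cn|j _]; first exact: coprimen1.
  by rewrite coprimeMr cm.
by apply: pnat_coprime (part_pnat _ _) (wnat j).
Qed.

Section factor_extraction.
Variables (R : realType) (T : finType) (v : T -> int) (r : nat).
Variable (a : 'I_r.+1 -> int).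

Let u m x : nat := `|(v x + a m)%R|%N.
Let uprod m (s : seq T) : nat := (\prod_(x <- s) u m x)%N.

(* The products [prod_i |v t_i + a_m|] agree, away from the primes dividing
   [L], for all values of [m]. *)
Definition common_part (L : nat) (s : seq T) : bool :=
  all (fun x => [forall m, v x + a m != 0]) s &&
  [forall m, (\prod_(x <- s) `|(v x + a m)%R|)`_\pi(L)^' ==
             (\prod_(x <- s) `|(v x + a ord0)%R|)`_\pi(L)^']%N.

(** [Lmax] bounds every modulus met in the induction, each step multiplying [L] by at most [Y]; [B]
    bounds the sums for all these moduli at once. *)
Variables (B : R) (Y Lmax : nat).
Hypotheses (B0 : 0 <= B) (Y0 : (0 < Y)%N).
Hypothesis HB : forall (L : nat) m, (0 < L <= Lmax)%N ->
  \sum_(x | v x + a m != 0) ((`|(v x + a m)%R| `_\pi(L)^')%N)%:R^-1 <= B.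
Hypothesis HY : forall x, (\prod_m `|(v x + a m)%R| <= Y)%N.

Let e : R := r.+1%:R^-1.
(** An arithmetic mean, chosen to dominate the geometric mean of the same reciprocals and to be easy
    to sum over [x]. *)
Let mu L x : R := (\sum_m ((u m x)`_\pi(L)^')%N%:R^-1) / r.+1%:R.

Let e0 : 0 < e. Proof. by rewrite invr_gt0. Qed.

Let uprod_cons m x s : uprod m (x :: s) = (u m x * uprod m s)%N.
Proof. exact: big_cons. Qed.

(** If [c] and [c'] are the common parts before and after removing [x], and [W] is the product of
    the parts of the [u m x] prime to [L], then [W c'] divides [c]. Hence
    [c^(-e) <= W^(-e) c'^(-e)], and [W^(-e)] is a geometric mean bounded by [mu L x]. *)
Let common_cons L x (s : seq T) : (0 < L)%N ->
  (forall m l, m != l -> (`|a m - a l| %| L)%N) ->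
  common_part L (x :: s) ->
  let L' := (L * \prod_m u m x)%N in
  [/\ [forall m, v x + a m != 0], common_part L' s &
    ((uprod ord0 (x :: s))`_\pi(L)^')%N%:R `^ (- e) <=
    mu L x * ((uprod ord0 s)`_\pi(L')^')%N%:R `^ (- e)].
Proof.
move=> L0 aL /andP[/= /andP[/forallP xnz snz] /forallP eqs].
set L' := (L * _)%N.
have u0 m : (0 < u m x)%N by rewrite absz_gt0.
have up0 m : (0 < uprod m s)%N.
  rewrite /uprod big_seq; apply: prodn_cond_gt0 => y ys.
  by rewrite absz_gt0; have /forallP := allP snz _ ys; apply.
(* A common divisor of two shifted values divides the difference of the shifts, hence [L]. *)
have gu m l : m != l -> (gcdn (u m x) (u l x) %| L)%N.
  move=> ml; apply: dvdn_trans (aL _ _ ml).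
  have -> : a m - a l = (v x + a m) - (v x + a l) by ring.
  have : (gcdz (v x + a m) (v x + a l) %| (v x + a m) - (v x + a l))%Z.
    by rewrite rpredB// ?dvdz_gcdl ?dvdz_gcdr.
  by [].
have ec m : ((u m x * uprod m s)`_\pi(L)^' = (uprod ord0 (x :: s))`_\pi(L)^')%N.
  by rewrite -uprod_cons; apply/eqP; exact: eqs.
have [AE dv] := coprime_part_split _ _ _ _ _ L0 u0 up0 gu ec L' erefl.
split.
- exact/forallP.
- rewrite /common_part snz /=; apply/forallP => m; apply/eqP.
  by rewrite [LHS]AE [RHS]AE.
have /dvdn_leq := dv; rewrite part_gt0 => /(_ isT); rewrite -(AE ord0).
set W := (\prod_m _)%N; set c' := (_`__)%N; set c := (_`__)%N => Wc.
have W0 : (0 < W)%N by rewrite prodn_gt0// => m; rewrite part_gt0.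
have c'0 : (0 < c')%N by rewrite part_gt0.
have c0 : (0 < c)%N by rewrite part_gt0.
have muge : W%:R `^ (- e) <= mu L x.
  have E0 m : 0 <= ((u m x)`_\pi(L)^')%N%:R^-1 :> R by rewrite invr_ge0.
  have mu0 : 0 <= mu L x by rewrite divr_ge0// sumr_ge0.
  have := @leif_AGM R 'I_r.+1 predT (fun m => ((u m x)`_\pi(L)^')%N%:R^-1)
    (fun m _ => E0 m).
  rewrite card_ord => /leif_le; rewrite -/(mu L x) => AGM.
  have -> : W%:R `^ (- e) = (\prod_m ((u m x)`_\pi(L)^')%N%:R^-1) `^ e.
    by rewrite prodfV -natr_prod -/W -powR_inv1// -powRrM mulN1r.
  apply: (@le_trans _ _ ((mu L x ^+ r.+1) `^ e)).
    apply: (ge0_ler_powR (ltW e0)) AGM; rewrite nnegrE ?exprn_ge0//.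
    exact: prodr_ge0.
  by rewrite -powR_mulrn// -powRrM /e divff ?powRr1// pnatr_eq0.
apply: (@le_trans _ _ (W%:R `^ (- e) * c'%:R `^ (- e))).
  rewrite -powRM// -natrM !powRN lef_pV2 ?posrE ?powR_gt0 ?ltr0n ?muln_gt0 ?W0//.
  by rewrite (ge0_ler_powR (ltW e0)) ?nnegrE// ler_nat.
by rewrite ler_wpM2r// powR_ge0.
Qed.

(* Weighting each tuple by its common part to the power [-1/(r+1)] makes the
   induction on [s] multiplicative. *)
Lemma sum_common_part (s L : nat) : (0 < L)%N -> (L * Y ^ s <= Lmax)%N ->
  (forall m l, m != l -> (`|a m - a l| %| L)%N) ->
  \sum_(t : s.-tuple T | common_part L t)
    ((\prod_(x <- t) `|(v x + a ord0)%R|)`_\pi(L)^')%N%:R `^ (- r.+1%:R^-1) <=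
  B ^+ s.
Proof.
elim: s L => [|s IH] L L0 LY aL.
  rewrite expr0 -[leRHS](_ : \sum_(t : 0.-tuple T) 1 = 1); last first.
    by rewrite sumr_const card_tuple.
  rewrite big_mkcond; apply: ler_sum => t _; case: ifP => // _.
  by rewrite tuple0 big_nil partn1 powR1.
have Y1 x : [forall m, v x + a m != 0] -> (0 < \prod_m u m x)%N.
  by move=> /forallP xnz; rewrite prodn_gt0// => m; rewrite absz_gt0.
rewrite (sum_tupleS _ _ _ (common_part L) (fun t => ((uprod ord0 t)`_\pi(L)^')%N%:R `^ (- e))).
apply: (@le_trans _ _ (\sum_(x | [forall m, v x + a m != 0]) mu L x * B ^+ s)).
  rewrite [leRHS]big_mkcond; apply: ler_sum => x _; case: ifPn => [xnz|xz]; last first.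
    rewrite big1// => t /(common_cons _ _ _ L0 aL)[xnz].
    by rewrite xnz in xz.
  set L' := (L * \prod_m u m x)%N.
  have L'0 : (0 < L')%N by rewrite muln_gt0 L0 Y1.
  (* The new factor of [L] is at most [Y], using up one of the [s+1] factors [Y] allowed below
     [Lmax]. *)
  have L'Y : (L' * Y ^ s <= Lmax)%N.
    rewrite (leq_trans _ LY)// /L' -mulnA leq_mul2l expnS leq_mul2r.
    by rewrite HY !orbT.
  have mu0 : 0 <= mu L x by rewrite divr_ge0// sumr_ge0// => m _; rewrite invr_ge0.
  have aL' m l : m != l -> (`|a m - a l| %| L')%N.
    by move=> /aL h; rewrite dvdn_mulr.
  apply: le_trans (ler_wpM2l mu0 (IH L' L'0 L'Y aL')).
  rewrite mulr_sumr big_mkcond [leRHS]big_mkcond; apply: ler_sum => t _.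
  case: ifPn => [/(common_cons _ _ _ L0 aL)[_ ct le]|_].
    by rewrite ct.
  by case: ifP => // _; rewrite mulr_ge0// powR_ge0.
rewrite -mulr_suml exprS ler_wpM2r ?exprn_ge0//.
(* After the exchange each of the [r+1] shifts contributes at most [B], which cancels the
   denominator of [mu]. *)
rewrite -mulr_suml ler_pdivrMr// exchange_big /= mulr_natr.
apply: (@le_trans _ _ (\sum_(m < r.+1) B)); last by rewrite sumr_const card_ord.
apply: ler_sum => m _; have LL : (0 < L <= Lmax)%N.
  by rewrite L0 (leq_trans _ LY)// leq_pmulr// expn_gt0 Y0.
apply: le_trans (HB L m LL); rewrite big_mkcond [leRHS]big_mkcond.
apply: ler_sum => x _; case: ifPn => [/forallP -> //|_].
by case: ifP => // _; rewrite invr_ge0.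
Qed.
End factor_extraction.

(** * The product shared by the entries of a nontrivial solution *)

(** All that the counting retains of the system; for a solution, [c] is the elementary symmetric
    function of degree [2k+1]. *)
Definition shared_product (z : seq int) : Prop := exists2 c : int, c != 0 &
  forall w, w \in z -> w != 0 /\ \prod_(u <- z) (u + w) = 2 * w * c.

Lemma shared_product_perm (s t : seq int) :
  perm_eq s t -> shared_product s -> shared_product t.
Proof.
move=> st [c c0 hc]; exists c => // w; rewrite -(perm_mem st) => /hc[w0 e].
by split=> //; rewrite -e; exact/esym/perm_big.
Qed.

(** If [c] were 0, all odd elementary symmetric functions of [z] would vanish, so [z] and [-z] would
    agree up to order. Their positive entries are [x] and [y] respectively, so [x] would be a
    permutation of [y]. *)
Lemma odd_system_shared_product (k : nat) (x y : seq int) :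
  size x = k.+1 -> size y = k.+1 ->
  all (> 0) x -> all (> 0) y ->
  (forall j, (1 <= j <= k)%N ->
     \sum_(u <- x) u ^+ (2 * j - 1) = \sum_(u <- y) u ^+ (2 * j - 1)) ->
  ~~ perm_eq x y -> shared_product (x ++ map -%R y).
Proof.
move=> sx sy x0 y0 hxy nxy; set z := x ++ _.
have sz : size z = (2 * k + 2)%N by rewrite size_cat size_map sx sy; lia.
have hz j : (1 <= j <= k)%N -> \sum_(u <- z) u ^+ (2 * j - 1) = 0.
  move=> jk; rewrite big_cat big_map /= hxy//.
  have o : odd (2 * j - 1) by have := andP jk; lia.
  by under [X in _ + X]eq_bigr do rewrite exprNn -signr_odd o mulN1r;
    rewrite sumrN subrr.
have z0 w : w \in z -> w != 0.
  rewrite mem_cat => /orP[/(allP x0)|/mapP[w' /(allP y0) w'0 ->]].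
    by move=> /gt_eqF ->.
  by rewrite oppr_eq0 gt_eqF.
exists (elem_gen z)`_(2 * k + 1).
  apply: contra nxy => /eqP c0.
  have ez : elem_gen (map -%R z) = elem_gen z.
    apply/polyP => i; rewrite elem_gen_opp -signr_odd; case: (boolP (odd i)) => io.
      have [i2|i2] := ltnP i (2 * k); first by rewrite (odd_elem_eq0 k z hz)// mulr0.
      have [i3|i3] := leqP i (2 * k + 2); last first.
        by rewrite nth_default ?mulr0// (leq_trans (size_elem_gen _))// sz.
      have -> : i = (2 * k + 1)%N by have := odd_double_half i; lia.
      by rewrite c0 mulr0.
    by rewrite mul1r.
  have n1 : 0 \notin map -%R z.
    by apply/mapP => -[w /z0 w0 /esym/eqP]; rewrite oppr_eq0 (negbTE w0).
  have n2 : 0 \notin z by apply/negP => /z0; rewrite eqxx.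
  have := perm_filter (> 0) (elem_gen_inj _ _ n1 n2 ez).
  rewrite /z map_cat -map_comp.
  rewrite !filter_cat /=.
  have xx : [seq i <- x | 0 < i] = x by exact/all_filterP.
  have yy : [seq i <- map (-%R \o -%R) y | 0 < i] = y.
    rewrite (@eq_map _ _ _ id) ?map_id; first exact/all_filterP.
    by move=> i /=; rewrite opprK.
  have ng (s : seq int) : all (> 0) s -> [seq i <- map -%R s | 0 < i] = [::].
    move=> s0; apply/eqP; rewrite -(negbK (_ == _)) -has_filter;
      apply/hasPn => _ /mapP[i /(allP s0) i0 ->].
    by rewrite /= oppr_gt0 -leNgt ltW.
  by rewrite xx yy !ng// cats0 /= perm_sym.
move=> w wz; split; first exact: z0.
by rewrite (prod_add_odd_system k)// z0.
Qed.

(** * Completions of a prefix of distinct entries *)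

Lemma sum_tuple_cat (V : nmodType) (T : finType) (m n : nat) (P : pred (seq T))
    (F : seq T -> V) :
  \sum_(t : (m + n).-tuple T | P t) F t =
  \sum_(x : m.-tuple T) \sum_(y : n.-tuple T | P (x ++ y)) F (x ++ y).
Proof.
rewrite pair_big_dep /=.
pose f (p : m.-tuple T * n.-tuple T) : (m + n).-tuple T := [tuple of p.1 ++ p.2].
rewrite (reindex f) //=; apply: onW_bij; apply: inj_card_bij.
  move=> [x y] [x' y'] /(congr1 val)/= /eqP.
  by rewrite eqseq_cat ?size_tuple// => /andP[/eqP/val_inj -> /eqP/val_inj ->].
by rewrite card_prod !card_tuple expnD.
Qed.

Lemma ler_sum_inj_iota (R : realType) (T : finType) (D : pred T) (g : T -> nat)
    (f : nat -> R) (X : nat) :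
  (forall u, 0 <= f u) -> {in D &, injective g} ->
  (forall x, D x -> (0 < g x <= X)%N) ->
  \sum_(x | D x) f (g x) <= \sum_(1 <= u < X.+1) f u.
Proof.
move=> f0 ginj gX; rewrite -big_enum -(big_map g predT f) /=.
set s := map _ _.
have us : uniq s.
  by rewrite map_inj_in_uniq ?enum_uniq// => x y; rewrite !mem_enum; exact: ginj.
rewrite [leRHS](bigID (mem s)) /= (_ : \sum_(1 <= u < X.+1 | u \in s) f u =
    \sum_(u <- s) f u); first by rewrite lerDl sumr_ge0.
rewrite -[LHS]big_filter; apply: perm_big; apply: uniq_perm => //.
  by rewrite filter_uniq// iota_uniq.
move=> u; rewrite mem_filter mem_index_iota ltnS; apply: andb_idr.
by move=> /mapP[x]; rewrite mem_enum => /gX gxX ->.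
Qed.

(** The absolute value is injective on each sign of [v x + b], whence the factor 2. *)
Lemma sum_absz_le (R : realType) (T : finType) (v : T -> int) (b : int)
    (f : nat -> R) (X : nat) :
  (forall u, 0 <= f u) -> injective v -> (forall x, (`|(v x + b)%R| <= X)%N) ->
  \sum_(x | v x + b != 0) f `|(v x + b)%R|%N <= 2 * \sum_(1 <= u < X.+1) f u.
Proof.
move=> f0 vinj vX; rewrite (bigID (fun x => 0 < v x + b)) /= mulr2n mulrDl mul1r.
apply: lerD; apply: ler_sum_inj_iota => //.
- by move=> x y /andP[_ x0] /andP[_ y0] e; apply: vinj; lia.
- by move=> x /andP[x0 _]; rewrite vX absz_gt0 x0.
- move=> x y; rewrite !unfold_in => /andP[_ x0] /andP[_ y0] e; apply: vinj; lia.
- by move=> x /andP[x0 _]; rewrite vX absz_gt0 x0.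
Qed.

Lemma partn_pi'_dvd (L x : nat) : (0 < L)%N -> (x %| L)%N ->
  (x`_\pi(L)^' = 1)%N.
Proof.
move=> L0 xL; apply: part_p'nat; apply/pnatP; first exact: dvdn_gt0 xL.
move=> p pp px; rewrite /negn !inE negbK mem_primes pp L0.
exact: dvdn_trans xL.
Qed.

Lemma absz_prod (I : Type) (s : seq I) (F : I -> int) :
  `|(\prod_(i <- s) F i)%R|%N = (\prod_(i <- s) `|F i|)%N.
Proof. exact: (big_morph absz abszM). Qed.

Section fixed_prefix.
Variables (R : realType) (d C : R).
Hypothesis C0 : 0 <= C.
Hypothesis CP : forall L X : nat, (0 < L)%N ->
    \sum_(1 <= u < X.+1) ((u`_\pi(L)^')%N)%:R^-1 <= C * (X%:R * L%:R) `^ d.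
Hypothesis d0 : 0 < d.
Variables (T : finType) (v : T -> int) (Q : nat).
Hypotheses (Q0 : (0 < Q)%N) (vinj : injective v) (vQ : forall x, (`|v x| <= Q)%N).

(** The entries of [p] serve as shifts. With [L] absorbing all that depends on the prefix alone,
    every completion has a common part of size at most [(2Q)^s], so its weight in [sum_common_part]
    is bounded below and the weighted sum bounds the count. *)
Lemma card_fixed_prefix (r s : nat) (p : r.+1.-tuple T) : uniq p ->
  #|[pred w : s.-tuple T | `[< shared_product (map v (p ++ w)) >]]|%:R <=
  (2 * (C * ((2 * Q)%:R `^ (1 + r.+1 * (1 + 2 * r.+1) + r.+1 * s)%:R) `^ d)) ^+ s
    * ((2 * Q)%:R `^ s%:R) `^ (r.+1%:R^-1).
Proof.
move=> up; set X := (2 * Q)%N; set B := 2 * _.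
have X0 : (0 < X)%N by rewrite muln_gt0.
have B0 : 0 <= B by rewrite mulr_ge0// mulr_ge0// powR_ge0.
set S := [pred w | _].
(* A single completion suffices to show that the [a m] and the sums [a l + a m] are nonzero. *)
have [w0 w0S|S0] := pickP S; last first.
  by rewrite eq_card0// mulr_ge0// ?exprn_ge0// powR_ge0.
pose a (m : 'I_r.+1) := v (tnth p m).
have az m w : a m \in map v (p ++ w).
  by apply: map_f; rewrite mem_cat mem_tnth.
have prodE m (w : seq T) : \prod_(u <- map v (p ++ w)) (u + a m) =
    (\prod_l (a l + a m)) * \prod_(x <- w) (v x + a m).
  by rewrite big_map big_cat big_tuple.
have nz w : shared_product (map v (p ++ w)) -> forall m,
    [/\ a m != 0, \prod_l (a l + a m) != 0 & \prod_(x <- w) (v x + a m) != 0].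
  move=> [c c0 hc] m; have [am0] := hc _ (az m w).
  rewrite prodE => e; split => //; apply/eqP => h0; move/eqP: e.
    by rewrite h0 mul0r eq_sym !mulf_eq0 (negbTE am0) (negbTE c0).
  by rewrite h0 mulr0 eq_sym !mulf_eq0 (negbTE am0) (negbTE c0).
have a0 m : (0 < `|a m|)%N.
  by rewrite absz_gt0; have [] := nz _ (asboolP _ w0S) m.
have K0 m : (0 < `|(\prod_l (a l + a m))%R|)%N.
  by rewrite absz_gt0; have [] := nz _ (asboolP _ w0S) m.
(* The value 1 replaces the zero difference on the diagonal and keeps [L] positive. *)
pose D m l := if l == m then 1%N else `|(a m - a l)%R|%N.
have D0 m l : (0 < D m l)%N.
  rewrite /D; case: eqP => // /eqP lm; rewrite absz_gt0 subr_eq0.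
  by apply: contraNneq lm => /vinj/(tuple_uniqP _ up) ->.
pose F m := (2 * `|a m| * `|(\prod_l (a l + a m))%R| * \prod_l D m l)%N.
have F0 m : (0 < F m)%N by rewrite /F !muln_gt0 a0 K0 prodn_gt0.
pose L := (\prod_m F m)%N.
have L0 : (0 < L)%N by rewrite prodn_gt0.
have FL m : (F m %| L)%N by rewrite /L (bigD1 m)//= dvdn_mulr.
have aL m l : m != l -> (`|a m - a l| %| L)%N.
  move=> ml; apply: dvdn_trans (FL m); rewrite /F dvdn_mull// (bigD1 l)//= /D.
  by rewrite eq_sym (negbTE ml) dvdn_mulr.
have aX m : (`|a m| <= Q)%N by exact: vQ.
(* In [F m], [2 |a m|] and each of the [2(r+1)] factors of the two products are at most [X]. *)
have LX : (L <= X ^ (r.+1 * (1 + 2 * r.+1)))%N.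
  rewrite mulnC expnM -[in leqRHS](card_ord r.+1) -prod_nat_const.
  apply: leq_prod => m _; rewrite expnD expn1 mul2n -addnn expnD mulnA.
  have XE : (X ^ r.+1 = \prod_(l < r.+1) X)%N by rewrite prod_nat_const card_ord.
  rewrite !card_ord XE /F absz_prod.
  rewrite !leq_mul ?leq_mul2l ?aX//; apply: leq_prod => l _.
    by have := aX l; have := aX m; lia.
  by rewrite /D; case: eqP => // _; have := aX l; have := aX m; lia.
pose Lmax := (X ^ (r.+1 * (1 + 2 * r.+1) + r.+1 * s))%N.
have vaX x m : (`|(v x + a m)%R| <= X)%N by have := vQ x; have := aX m; lia.
have HB (M : nat) m : (0 < M <= Lmax)%N ->
    \sum_(x | v x + a m != 0) ((`|(v x + a m)%R| `_\pi(M)^')%N)%:R^-1 <= B.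
  move=> /andP[M0 MX].
  pose f u : R := ((u`_\pi(M)^')%N)%:R^-1.
  have := @sum_absz_le R T v (a m) f X (fun u => _) vinj (fun x => vaX x m).
  move=> /(_ _)/le_trans; apply; first by move=> u; rewrite invr_ge0.
  rewrite ler_wpM2l// (le_trans (CP _ _ M0))// ler_wpM2l//.
  rewrite (ge0_ler_powR (ltW d0)) ?nnegrE ?mulr_ge0 ?powR_ge0//.
  rewrite powR_mulrn// -natrX -natrM ler_nat -addnA expnD expn1.
  by rewrite leq_mul2l MX orbT.
have HY x : (\prod_m `|(v x + a m)%R| <= X ^ r.+1)%N.
  by rewrite -[in leqRHS](card_ord r.+1) -prod_nat_const; apply: leq_prod.
have LY : (L * (X ^ r.+1) ^ s <= Lmax)%N.
  by rewrite /Lmax expnD -expnM leq_mul2r LX orbT.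
have Y0 : (0 < X ^ r.+1)%N by rewrite expn_gt0 X0.
have := sum_common_part R T v r a B (X ^ r.+1) Lmax B0 Y0 HB HY s L L0 LY aL.
(* In the equation for [w = a m], the factors [2 a m] and [prod_l (a l + a m)] involve only primes
   of [L]; the part prime to [L] of what remains is that of [c], whatever [m]. *)
have Scommon w : w \in S -> common_part T v r a L w.
  move=> /asboolP Sw; have nzw := nz _ Sw; case: Sw => c c0 hc.
  have key m : ((\prod_(x <- w) `|(v x + a m)%R|)`_\pi(L)^' = `|c| `_\pi(L)^')%N.
    have [_] := hc _ (az m w); have [am0 k0 pw0] := nzw m.
    rewrite prodE => /(congr1 absz); rewrite !abszM.
    move=> /(congr1 (fun n => n`_\pi(L)^')%N).
    have strip x : (x %| F m)%N -> (x`_\pi(L)^' = 1)%N.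
      by move=> xF; apply: partn_pi'_dvd => //; apply: dvdn_trans (FL m).
    rewrite partnM ?absz_gt0// (strip `|(\prod_l (a l + a m))%R|%N); last first.
      by rewrite /F dvdn_mulr// dvdn_mull.
    rewrite partnM ?muln_gt0 ?absz_gt0 ?am0// (strip (2 * `|a m|)%N) ?mul1n
      ?absz_prod//.
    by rewrite /F -mulnA dvdn_mulr.
  apply/andP; split; last by apply/forallP => m; rewrite !key.
  apply/allP => x xw; apply/forallP => m; have [_ _] := nzw m.
  by apply: contraNneq => xm; rewrite prodf_seq_eq0; apply/hasP; exists x => //=;
    rewrite xm.
set e := r.+1%:R^-1.
have Xs : 0 < (X%:R `^ s%:R) `^ e :> R by rewrite !powR_gt0// ltr0n.
(* Each completion is compared with its weight, which is at least [(X^s)^(-e)]. *)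
move=> le; rewrite -ler_pdivrMr// -powRN; apply: le_trans le.
rewrite -sum1_card natr_sum mulr_suml big_mkcond [leRHS]big_mkcond.
apply: ler_sum => w _; case: ifPn => [wS|_]; last first.
  by case: ifP => // _; rewrite powR_ge0.
rewrite Scommon// mul1r !powRN lef_pV2 ?posrE// ?powR_gt0 ?ltr0n ?part_gt0//.
have e0 : 0 <= e by rewrite invr_ge0.
rewrite (ge0_ler_powR e0) ?nnegrE ?powR_ge0// powR_mulrn// -natrX ler_nat.
have [_ _] := nz _ (asboolP _ wS) ord0; rewrite -absz_gt0 absz_prod => W0.
rewrite (leq_trans (dvdn_leq W0 (dvdn_part _ _)))// big_tuple.
by rewrite -[in leqRHS](card_ord s) -prod_nat_const; apply: leq_prod.
Qed.
End fixed_prefix.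

(** * Counting *)

(** Such a tuple is recovered from a list of [r+1] values and an index into it at each place; [x0]
    pads the list when there are fewer values. *)
Lemma card_few_distinct (T : finType) (x0 : T) (n r : nat) :
  (#|[pred z : n.-tuple T | size (undup z) <= r.+1]| <= #|T| ^ r.+1 * r.+1 ^ n)%N.
Proof.
pose f (p : r.+1.-tuple T * n.-tuple 'I_r.+1) : n.-tuple T :=
  [tuple tnth p.1 (tnth p.2 i) | i < n].
have <- : #|{: r.+1.-tuple T * n.-tuple 'I_r.+1}| = (#|T| ^ r.+1 * r.+1 ^ n)%N.
  by rewrite card_prod !card_tuple card_ord.
apply: leq_trans (leq_imset_card f _); apply/subset_leq_card/fintype.subsetP => z.
rewrite inE => zr; apply/imsetP.
exists ([tuple nth x0 (undup z) i | i < r.+1],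
        [tuple inord (index (tnth z i) (undup z)) | i < n]) => //.
apply: eq_from_tnth => i; rewrite !tnth_mktuple inordK ?nth_index//.
  by rewrite mem_undup mem_tnth.
by rewrite (leq_trans _ zr)// index_mem mem_undup mem_tnth.
Qed.

(** A permutation of the places brings distinct entries to the front, and there are [n!]
    permutations. *)
Lemma card_distinct_prefix (T : finType) (n r : nat) (P : pred (seq T)) :
  (forall s t : seq T, perm_eq s t -> P s -> P t) ->
  (#|[pred z : n.-tuple T | P z & r <= size (undup z)]| <=
   n`! * #|[pred z : n.-tuple T | P z & uniq (take r z)]|)%N.
Proof.
move=> Pperm; set A := [pred z : n.-tuple T | P z & uniq _].
pose f (p : {perm 'I_n} * n.-tuple T) : n.-tuple T :=
  [tuple tnth p.2 (p.1 i) | i < n].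
have <- : #|[predX [pred s : {perm 'I_n} | true] & A]| = (n`! * #|A|)%N.
  by rewrite cardX cardT /= -cardE card_Sn.
apply: leq_trans (leq_imset_card f _); apply/subset_leq_card/fintype.subsetP => z.
rewrite inE => /andP[Pz rz].
have [s zs] := perm_to_subseq (undup_subseq z).
have st : size (undup z ++ s) == n by rewrite -(perm_size zs) size_tuple.
have /tuple_permP[p pE] : perm_eq z (Tuple st) by [].
apply/imsetP; exists (p, Tuple st); last exact: val_inj.
rewrite !inE /= (Pperm _ _ zs Pz) /= take_cat.
case: ltnP => h; first by rewrite take_uniq// undup_uniq.
have -> : (r - size (undup z) = 0)%N by apply/eqP; rewrite subn_eq0.
by rewrite take0 cats0 undup_uniq.
Qed.

Section box.
Variables (R : realType) (d C : R).
Hypothesis C0 : 0 <= C.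
Hypothesis CP : forall L X : nat, (0 < L)%N ->
    \sum_(1 <= u < X.+1) ((u`_\pi(L)^')%N)%:R^-1 <= C * (X%:R * L%:R) `^ d.
Hypothesis d0 : 0 < d.
Variables (T : finType) (v : T -> int) (Q : nat).
Hypotheses (Q0 : (0 < Q)%N) (vinj : injective v) (vQ : forall x, (`|v x| <= Q)%N).

(** The two terms correspond to tuples with at least [r+2] distinct entries, handled by fixing a
    prefix, and to those with at most [r+1]. *)
Lemma card_shared_product (r n : nat) (x0 : T) : (r.+2 <= n)%N ->
  #|[pred z : n.-tuple T | `[< shared_product (map v z) >]]|%:R <=
  n`!%:R * (#|T|%:R ^+ r.+2 *
    ((2 * (C * ((2 * Q)%:R `^ (1 + r.+2 * (1 + 2 * r.+2) + r.+2 * (n - r.+2))%:R) `^ d))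
       ^+ (n - r.+2) * ((2 * Q)%:R `^ (n - r.+2)%:R) `^ (r.+2%:R^-1)))
  + #|T|%:R ^+ r.+1 * r.+1%:R ^+ n.
Proof.
move=> rn; pose s := (n - r.+2)%N; rewrite -/s.
have nE : n = (r.+2 + s)%N by rewrite subnKC.
pose P (z : seq T) := `[< shared_product (map v z) >].
apply: (@le_trans _ _ (#|[pred z : n.-tuple T | P z & (r.+2 <= size (undup z))%N]| +
   #|[pred z : n.-tuple T | (size (undup z) <= r.+1)%N]|)%N%:R).
  rewrite ler_nat -cardUI (leq_trans _ (leq_addr _ _))//.
  apply/subset_leq_card/fintype.subsetP => z zP.
  by rewrite !inE [P z]zP /= ltnNge; case: leqP.
rewrite natrD; apply: lerD; last first.
  by rewrite -!natrX -natrM ler_nat card_few_distinct.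
have Pp s1 t1 : perm_eq s1 t1 -> P s1 -> P t1.
  move=> st /asboolP h; apply/asboolP; apply: shared_product_perm h.
  exact: perm_map.
rewrite (le_trans (y := (n`! * #|[pred z : n.-tuple T | P z & uniq (take r.+2 z)]|)%N%:R))//.
  by rewrite ler_nat card_distinct_prefix.
rewrite natrM ler_wpM2l//.
move: (s) nE => s' nE; rewrite {}nE.
set B := (X in _ * X).
have B0 : 0 <= B.
  by rewrite mulr_ge0 ?exprn_ge0 ?mulr_ge0// powR_ge0.
rewrite -sum1_card natr_sum.
rewrite (sum_tuple_cat _ T r.+2 s' (fun z => P z && uniq (take r.+2 z)) (fun=> 1%:R)).
apply: (@le_trans _ _ (\sum_(p : r.+2.-tuple T) B)); last first.
  by rewrite sumr_const card_tuple -natrX mulr_natl.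
apply: ler_sum => p _.
have [up|nup] := boolP (uniq p); last first.
  rewrite big_pred0// => y; rewrite take_size_cat ?size_tuple//.
  by rewrite (negbTE nup) andbF.
apply: le_trans (card_fixed_prefix R d C C0 CP d0 T v Q Q0 vinj vQ r.+1 s' p up).
rewrite -sum1_card natr_sum; rewrite le_eqVlt; apply/orP; left.
apply/eqP/eq_bigl => y; by rewrite take_size_cat ?size_tuple// up andbT.
Qed.
End box.

(** * From solutions to tuples of indices *)

(** A finite type indexing the integers from [-Q] to [Q], so that entries of [x] and of [-y] live in
    the same type. *)
Definition centered (Q : nat) (i : 'I_(2 * Q).+1) : int := (i : nat)%:Z - Q%:Z.

Lemma centered_inj Q : injective (centered Q).
Proof. by move=> i j; rewrite /centered => ij; apply: val_inj => /=; lia. Qed.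

Lemma absz_centered Q i : (`|centered Q i| <= Q)%N.
Proof. by rewrite /centered; have := ltn_ord i; lia. Qed.

Lemma int_box_bounds (R : realType) (n : nat) (P : R) (x : n.-tuple int) : 1 <= P ->
  int_box P x -> forall u, u \in (x : seq int) ->
  0 < u /\ (`|u| <= Num.truncn P)%N.
Proof.
move=> P1 xP u /tnthP[i ->]; have /andP[x1 xle] := xP i.
have x0 : 0 < tnth x i by rewrite -(ltr0z R) (lt_le_trans ltr01).
have xE : (`|tnth x i|%N : int) = tnth x i by rewrite gez0_abs ?ltW.
split=> //; rewrite truncn_ge_nat ?(le_trans ler01)//.
by rewrite -[_%:R]/((Posz _)%:~R) xE.
Qed.

(** The map sending [(x, y)] to the indices of [x] followed by those of [-y] is injective on
    solutions, and nondiagonal ones have a shared product. *)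
Lemma Vstar_sub_Lstar_le (R : realType) (k : nat) (P : R) : 1 <= P ->
  (Vstar k P)%:R - (Lstar k P)%:R <=
  #|[pred z : (k.+1 + k.+1).-tuple 'I_(2 * Num.truncn P).+1 |
      `[< shared_product (map (centered (Num.truncn P)) z) >]]|%:R :> R.
Proof.
move=> P1; set Q := Num.truncn P; set S := [pred z | _].
pose V := fset_set (solutions k P); pose L := fset_set (diagonal_pairs k P).
rewrite lerBlDl -natrD ler_nat /Vstar /Lstar -/V -/L.
have : (#|` V| <= #|` L| + #|` (V `\` L)%fset|)%N.
  by rewrite -(cardfsID L V) leq_add2r fsubset_leq_card// fsubsetIr.
move=> /leq_trans; apply; rewrite leq_add2l.
pose enc (u : int) : 'I_(2 * Q).+1 := inord `|u + Q%:Z|.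
have encK u : (`|u| <= Q)%N -> centered Q (enc u) = u.
  by move=> uQ; rewrite /centered /enc inordK; lia.
pose f (xy : k.+1.-tuple int * k.+1.-tuple int) : (k.+1 + k.+1).-tuple 'I_(2 * Q).+1 :=
  [tuple of map enc xy.1 ++ map (enc \o -%R) xy.2].
have inV xy : xy \in V -> solutions k P xy.
  by rewrite in_fset_set ?inE//; exact: finite_solutions.
have fE xy : xy \in V -> map (centered Q) (f xy) = xy.1 ++ map -%R xy.2.
  move=> /inV[x1 y1 _]; rewrite /= map_cat -!map_comp; congr cat.
    rewrite -[RHS]map_id; apply/eq_in_map => u /(int_box_bounds _ _ _ _ P1 x1)[_ uQ] /=.
    exact: encK.
  apply/eq_in_map => u /(int_box_bounds _ _ _ _ P1 y1)[_ uQ] /=.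
  by rewrite encK// abszN.
rewrite cardE -(size_map f); apply: uniq_leq_size.
  rewrite map_inj_in_uniq ?fset_uniq// => xy xy'.
  rewrite !inE => /andP[_ xyV] /andP[_ xyV'] e.
  have := fE _ xyV; rewrite e (fE _ xyV') => /eqP.
  rewrite eqseq_cat ?size_tuple// => /andP[/eqP e1 /eqP e2].
  case: xy xy' e1 e2 {e xyV xyV'} => [x y] [x' y'] /= /val_inj -> /(inj_map oppr_inj).
  by move/val_inj => ->.
move=> _ /mapP[xy xyVL ->]; move: xyVL; rewrite !inE => /andP[nL xyV].
rewrite mem_enum; apply/asboolP; rewrite fE//.
have [x1 y1 hxy] := inV _ xyV.
apply: (odd_system_shared_product k); rewrite ?size_tuple//.
- by apply/allP => u /(int_box_bounds _ _ _ _ P1 x1)[].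
- by apply/allP => u /(int_box_bounds _ _ _ _ P1 y1)[].
- by move=> j jk; rewrite !big_tuple; exact: hxy.
apply: contra nL => pxy; rewrite in_fset_set; last exact: finite_diagonal_pairs.
by rewrite inE; split.
Qed.

(** * The exponent *)

Lemma paucity_bound (R : realType) (k r : nat) (eps : R) :
  (r.+2 <= (2 * k).+1)%N -> 0 < eps ->
  exists2 K : R, 0 <= K & forall P : R, 1 <= P ->
    (Vstar k P)%:R - (Lstar k P)%:R <= K * P `^ (alpha_term R k r.+2 + eps).
Proof.
move=> rk eps0; pose n := (k.+1 + k.+1)%N; pose s := (n - r.+2)%N.
have rn : (r.+2 <= n)%N by rewrite /n; lia.
pose A := (1 + r.+2 * (1 + 2 * r.+2) + r.+2 * s)%N.
(* The power [(2Q)^(A d)] occurs [s] times, and [A d s <= eps]; [s.+1] makes the denominator visibly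
   positive. *)
pose d := eps / (A * s.+1)%:R.
have A0 : 0 < (A * s.+1)%:R :> R by rewrite ltr0n.
have d0 : 0 < d by rewrite divr_gt0.
have [C C0 CP] := smooth_harmonic_le R d d0.
pose e : R := r.+2%:R^-1.
pose K := n`!%:R * 3 ^+ r.+2 * (2 * C) ^+ s * 2 `^ (eps + s%:R * e)
  + 3 ^+ r.+1 * r.+1%:R ^+ n.
have C2 : 0 <= 2 * C by rewrite mulr_ge0.
have h3 m : 0 <= 3 ^+ m :> R by rewrite exprn_ge0.
have h2 : 0 <= (2 * C) ^+ s by rewrite exprn_ge0.
have K1 : 0 <= n`!%:R * 3 ^+ r.+2 * (2 * C) ^+ s by rewrite mulr_ge0// mulr_ge0.
have K2 : 0 <= r.+1%:R ^+ n :> R by rewrite exprn_ge0.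
exists K.
  apply: addr_ge0; last exact: mulr_ge0 (h3 _) K2.
  by apply: mulr_ge0 K1 _; rewrite powR_ge0.
move=> P P1; set Q := Num.truncn P.
have P0 : 0 <= P := le_trans ler01 P1.
have Q0 : (0 < Q)%N by rewrite truncn_ge_nat.
have QP : Q%:R <= P by rewrite truncn_le.
apply: le_trans (Vstar_sub_Lstar_le _ _ _ P1) _.
apply: le_trans (card_shared_product R d C C0 CP d0 _ (centered Q) Q Q0
  (centered_inj Q) (absz_centered Q) r n ord0 rn) _.
rewrite card_ord -/s -/A -/e; set N : R := (2 * Q).+1%:R; set X : R := (2 * Q)%:R.
have N3 : N <= 3 * P.
  by rewrite /N -natr1 natrM; lra.
have X2 : X <= 2 * P by rewrite /X natrM ler_wpM2l.
have X1 : 1 <= X by rewrite /X ler1n muln_gt0.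
have X0 : 0 <= X by [].
have N0 : 0 <= N by [].
have e0 : 0 <= e by rewrite invr_ge0.
have alphaE : alpha_term R k r.+2 = r.+2%:R + s%:R * e.
  rewrite /alpha_term /s natrB// /n /e mulrBl divff ?pnatr_eq0//.
  by rewrite (_ : k.+1 + k.+1 = 2 * k + 2)%N;
    [rewrite -addrA (addrC (- 1))|rewrite addnn doubleS addn2 mul2n].
have PD x y : P `^ (x + y) = P `^ x * P `^ y.
  by rewrite powRD//; apply/implyP => _; rewrite gt_eqF// (lt_le_trans ltr01).
rewrite /K [leRHS]mulrDl; apply: lerD; last first.
  rewrite mulrAC ler_wpM2r ?exprn_ge0//.
  apply: (@le_trans _ _ ((3 * P) ^+ r.+1)); first by rewrite lerXn2r ?nnegrE ?mulr_ge0.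
  rewrite exprMn ler_wpM2l ?exprn_ge0// -powR_mulrn// ler_powR// alphaE.
  rewrite -[X in X <= _]addr0 -addrA lerD ?ler_nat//.
  by rewrite addr_ge0 ?mulr_ge0// ltW.
have bX : ((X `^ A%:R) `^ d) ^+ s <= (2 * P) `^ eps.
  rewrite -powR_mulrn ?powR_ge0// -!powRrM.
  apply: (@le_trans _ _ (X `^ eps)).
    rewrite ler_powR// /d -mulrA mulrCA ger_pMr// [_^-1 * _]mulrC mulrA -natrM.
    by rewrite ler_pdivrMr// mul1r ler_nat leq_mul2l leqnSn orbT.
  by rewrite (ge0_ler_powR (ltW eps0)) ?nnegrE ?mulr_ge0.
have -> : (2 * (C * (X `^ A%:R) `^ d)) ^+ s = (2 * C) ^+ s * ((X `^ A%:R) `^ d) ^+ s.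
  by rewrite mulrA exprMn.
have bX2 : (X `^ s%:R) `^ e <= (2 * P) `^ (s%:R * e).
  by rewrite -powRrM ge0_ler_powR ?nnegrE ?mulr_ge0.
have bN : N ^+ r.+2 <= 3 ^+ r.+2 * P `^ r.+2%:R.
  by rewrite powR_mulrn// -exprMn lerXn2r ?nnegrE ?mulr_ge0.
have -> : n`!%:R * 3 ^+ r.+2 * (2 * C) ^+ s * 2 `^ (eps + s%:R * e)
    * P `^ (alpha_term R k r.+2 + eps) =
  n`!%:R * ((3 ^+ r.+2 * P `^ r.+2%:R) *
    ((2 * C) ^+ s * (2 * P) `^ eps * (2 * P) `^ (s%:R * e))).
  rewrite alphaE !PD !powRM// powRD ?pnatr_eq0 ?implybT//.
  by ring.
rewrite ler_wpM2l//; apply: ler_pM => //.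
- by rewrite exprn_ge0.
- by rewrite !mulr_ge0 ?exprn_ge0 ?powR_ge0 ?mulr_ge0.
apply: ler_pM => //; rewrite ?mulr_ge0 ?exprn_ge0 ?powR_ge0 ?mulr_ge0//.
by rewrite ler_wpM2l ?exprn_ge0 ?mulr_ge0.
Qed.

(* [(r + n/r)^2 = (r - n/r)^2 + 4n <= 4n + 1] for the integer [r] found here. *)
Lemma exists_pronic (n : nat) : (0 < n)%N ->
  exists2 r : nat, (0 < r)%N & (r * r - r <= n <= r * r + r)%N.
Proof.
move=> n0; have ex : exists r, (n <= r * r + r)%N by exists n; nia.
(* If the lower bound failed, [r - 1] would already satisfy the upper one, since
   [(r-1)^2 + (r-1) = r^2 - r]. *)
exists (ex_minn ex); case: ex_minnP => [[|r]//] hr hmin; first lia.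
rewrite hr andbT leqNgt; apply/negP => h.
have hh : (n <= r * r + r)%N by nia.
by have := hmin _ hh; rewrite ltnn.
Qed.

Lemma alpha_le_sqrt (R : realType) (k : nat) : (2 <= k)%N ->
  alpha R k <= Num.sqrt (8 * k + 9)%:R - 1.
Proof.
move=> k2; have [|r r0 /andP[rl ru]] := exists_pronic (2 * k + 2); first lia.
have rr : (2 <= r <= (2 * k).+1)%N by nia.
apply: le_trans (alpha_le R rr) _.
rewrite /alpha_term; set n : R := (2 * k + 2)%:R.
have rp : 0 < r%:R :> R by rewrite ltr0n.
rewrite addrAC lerD2r.
have -> : (8 * k + 9)%:R = 4 * n + 1 :> R by rewrite /n -natrM natr1; congr (_%:R); lia.
set t := _ + _; have t0 : 0 <= t by rewrite addr_ge0// divr_ge0.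
rewrite -(ger0_norm t0) -sqrtr_sqr ler_wsqrtr//.
(* The two pronic bounds, divided by [r], say that [|r - n/r| <= 1]. *)
have dl : -1 <= r%:R - n / r%:R.
  rewrite lerBrDr addrC -lerBrDr opprK ler_pdivrMr// mulrDl mul1r.
  by rewrite -natrM -natrD ler_nat; lia.
have du : r%:R - n / r%:R <= 1.
  rewrite lerBlDr -lerBlDl ler_pdivlMr// mulrBl mul1r lerBlDr -natrM -natrD ler_nat.
  by nia.
have tE : t ^+ 2 = (r%:R - n / r%:R) ^+ 2 + 4 * n.
  by rewrite /t; field; rewrite gt_eqF.
by rewrite tE addrC lerD2l; nra.
Qed.

Theorem theorem1p2 (R : realType) (k : nat) (hk : (2 <= k)%N) :
  (forall eps : R, 0 < eps ->
    exists C : R, forall P : R, 1 <= P ->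
      (Vstar k P)%:R - (Lstar k P)%:R <= C * P `^ (alpha R k + eps))
  /\
  (forall eps : R, 0 < eps ->
    exists C' : R, forall P : R, 1 <= P ->
      (Vstar k P)%:R - (Lstar k P)%:R
        <= C' * P `^ (Num.sqrt (8 * k + 9)%:R - 1 + eps)).
Proof.
(* The minimum is attained at some [r >= 2]. The sign of [C] is kept for passing to the larger
   exponent in the second claim. *)
have main (eps : R) : 0 < eps -> exists2 C : R, 0 <= C & forall P : R, 1 <= P ->
    (Vstar k P)%:R - (Lstar k P)%:R <= C * P `^ (alpha R k + eps).
  move=> eps0; have [|[|[|r]] // /andP[_ rk] ->] := @alpha_attained R k; first lia.
  exact: paucity_bound.
split=> eps /main[C C0 CP]; exists C => // P P1.
apply: le_trans (CP P P1) _; rewrite ler_wpM2l// ler_powR// lerD2r.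
exact: alpha_le_sqrt.
Qed.
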